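(* Let $w \ge 1$ and $a \ge 0$ be integers, let $n = 2w+a$, and suppose that there exists a nontrivial $1$-perfect code $C$ in $J(n,w)$. Write $\Phi_1(w,a) = 1+w(w+a) = p_1 p_2 \cdots p_r$ as a product of primes, and for $1 \le i \le r$ let $\alpha_i = \lfloor \log_{p_i}(w+a) \rfloor + 1$. Then the integers $\alpha_1,\ldots,\alpha_r$ are distinct and pairwise coprime.
   Context: For integers $0 \le w \le n$, the Johnson graph $J(n,w)$ has as vertex set $V^n_w$, the set of all $w$-element subsets of $\{1,2,\ldots,n\}$; two vertices are adjacent if their intersection has size $w-1$. The distance between two $w$-sets is half the size of their symmetric difference. The $1$-sphere of a vertex is the set of all $w$-sets within distance at most $1$ of it; for $n=2w+a$ it has cardinality $\Phi_1(w,a)=1+w(w+a)$. A code $C \subseteq V^n_w$ is called $1$-perfect if the $1$-spheres of the codewords of $C$ form a partition of $V^n_w$. A $1$-perfect code is called trivial if it consists of a single codeword, or if $n=2w$ and it consists of a pair of disjoint $w$-subsets; otherwise it is nontrivial. *)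

(* Defs.v *)
From mathcomp Require Import all_boot.

Set Implicit Arguments.
Unset Strict Implicit.
Unset Printing Implicit Defensive.

(* The vertices of J(n, w); the ground set {1, ..., n} is encoded as 'I_n. *)
Definition johnson_vertices (n w : nat) : {set {set 'I_n}} :=
  [set A : {set 'I_n} | #|A| == w].

(* The symmetric difference of two sets of equal size has even cardinality, so
   halving is exact on the vertices of J(n, w). *)
Definition johnson_dist (n : nat) (A B : {set 'I_n}) : nat :=
  #|(A :\: B) :|: (B :\: A)|./2.

Definition johnson_sphere1 (n w : nat) (A : {set 'I_n}) : {set {set 'I_n}} :=
  [set B in johnson_vertices n w | johnson_dist A B <= 1].

(* The spheres partition the vertex set as a family indexed by the codewords.
   As [partition] only sees the set of spheres, injectivity is required as
   well: for w = 1 all vertices have the same sphere. *)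
Definition perfect1 (n w : nat) (C : {set {set 'I_n}}) : Prop :=
  [/\ C \subset johnson_vertices n w,
      {in C &, injective (johnson_sphere1 w)}
    & partition [set johnson_sphere1 w A | A in C] (johnson_vertices n w)].

Definition trivial_code (n w : nat) (C : {set {set 'I_n}}) : Prop :=
  #|C| = 1 \/
  (n = 2 * w /\
   exists A B : {set 'I_n},
     [/\ A \in johnson_vertices n w, B \in johnson_vertices n w,
         [disjoint A & B] & C = [set A; B]]).

Definition nontrivial_perfect1 (n w : nat) (C : {set {set 'I_n}}) : Prop :=
  perfect1 w C /\ ~ trivial_code w C.

Definition Phi1 (w a : nat) : nat := 1 + w * (w + a).

(* For p > 1 and m > 0, [trunc_log p m] is the floor of log_p m. *)
Definition alpha (w a p : nat) : nat := trunc_log p (w + a) + 1.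

(* Main.v *)
Require Import Defs.
From mathcomp Require Import all_boot.
From mathcomp Require Import zify.

Set Implicit Arguments.
Unset Strict Implicit.
Unset Printing Implicit Defensive.

(** Let Phi = [Phi1 w a], the common size of the 1-spheres.

    A perfect code is a design of large strength.  For a set A of size t,
    every vertex containing A lies in exactly one sphere around a codeword;
    counting these vertices codeword by codeword expresses the number of
    codewords containing A through the numbers for the sets A minus a point.
    In this recurrence the number for A itself has coefficient
      t^2 - (n+1) t + Phi = e^2 + (a+1) e - (w-1),   e = w - t,
    which is an eigenvalue of the sphere matrix of J(n, w).  Let s be the
    least e for which it is positive.  For t <= w - s the recurrence
    determines the number, and Phi times it is 'C(n - t, w - t)
    ([perfect_degree]).  Hence Phi divides all these binomials, which form an
    edge of a triangle in Pascal's triangle; by Pascal's rule Phi divides the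
    whole triangle, in particular 'C(w + a + s, m) for s <= m <= w
    ([perfect_dvdn_window]).  The case m = 1 excludes s = 1 unless w = 1, and
    then minimality of s gives (s-1)(s+a) < w: the parameter a is less than w
    and s - 1 is less than the square root of w.

    Now let p be a prime divisor of Phi and q = p^(alpha - 1) <= w + a.  Some
    multiple m of q lies in the window [s, w] or in its mirror image.  By
    Kummer's theorem the only possible borrow in the base p subtraction of m
    from w + a + s is at the position alpha, and it can occur only if
    p^alpha <= w + a + s.  Since p divides the binomial, p^alpha lies in
    ]w + a, w + a + s], and Phi is squarefree ([dvdn_window_prime]).

    So distinct indices give distinct primes p, p' whose powers p^alpha and
    p'^alpha' both lie in this short interval.  If g > 1 divided both
    exponents, these would be two different g-th powers at distance less than
    s, but g-th powers of this size are further apart ([close_powers_eq]).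
    Hence the exponents are coprime, and they can coincide only if both are
    1; then p, p' > w + a, so that p p' > 1 + w (w + a) = Phi, although p p'
    divides Phi. *)

(** * Spheres of the Johnson graph *)

Lemma card_setD_comm (T : finType) (A B : {set T}) : #|A| = #|B| ->
  #|A :\: B| = #|B :\: A|.
Proof. by move=> eqAB; rewrite !cardsD eqAB setIC. Qed.

Lemma in_johnson_sphere1 (n w : nat) (c v : {set 'I_n}) : #|c| = w ->
  (v \in johnson_sphere1 w c) = (#|v| == w) && (#|c :\: v| <= 1).
Proof.
move=> cw; rewrite !inE /johnson_dist; case: eqP => //= vw.
rewrite cardsU (@card_setD_comm _ v c) ?cw ?vw //=.
rewrite (_ : _ :&: _ = set0) ?cards0; last first.
  by apply/setP => x; rewrite !inE; case: (x \in c); case: (x \in v).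
by rewrite subn0 addnn doubleK.
Qed.

Definition exchange (T : finType) (c : {set T}) (xy : T * T) : {set T} :=
  xy.2 |: (c :\ xy.1).

Lemma card_exchange (T : finType) (c : {set T}) (x y : T) :
  x \in c -> y \notin c -> #|exchange c (x, y)| = #|c|.
Proof.
move=> xc yc; rewrite /exchange cardsU1 !inE (negbTE yc) andbF /=.
by rewrite [in RHS](cardsD1 x) xc.
Qed.

Lemma setD_exchange (T : finType) (c : {set T}) (x y : T) :
  x \in c -> y \notin c -> c :\: exchange c (x, y) = [set x].
Proof.
move=> xc yc; apply/setP => z; rewrite !inE /=.
have [->|_] := eqVneq z x.
  by rewrite xc orbF andbT; apply: contraNneq yc => <-.
by case: (boolP (z \in c)); rewrite ?andbF //= orbT.
Qed.

Lemma exchange_setD (T : finType) (c : {set T}) (x y : T) :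
  x \in c -> y \notin c -> exchange c (x, y) :\: c = [set y].
Proof.
move=> xc yc; apply/setP => z; rewrite !inE /=.
by have [->|_] := eqVneq z y; [rewrite yc | case: (z \in c); rewrite ?andbF].
Qed.

Lemma exchange_inj (T : finType) (c : {set T}) :
  {in setX c (~: c) &, injective (exchange c)}.
Proof.
move=> [x y] [x' y']; rewrite !inE /= => /andP[xc yc] /andP[xc' yc'] eq_v.
have := setD_exchange xc yc; rewrite eq_v setD_exchange // => /set1_inj ->.
by have := exchange_setD xc yc; rewrite eq_v exchange_setD // => /set1_inj ->.
Qed.

Lemma exchangeP (T : finType) (c v : {set T}) : #|v| = #|c| ->
  #|c :\: v| = 1 ->
  exists x y, [/\ x \in c, y \notin c & v = exchange c (x, y)].
Proof.
move=> eq_vc cv1; have /eqP/cards1P[x cvE] := cv1.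
have : #|v :\: c| == 1 by rewrite -cv1; apply/eqP/card_setD_comm.
move/cards1P => [y vcE]; exists x, y.
have /setDP[xc _] : x \in c :\: v by rewrite cvE inE.
have /setDP[_ yc] : y \in v :\: c by rewrite vcE inE.
split=> //; apply/setP => z; rewrite !inE /=.
move/setP/(_ z): cvE; move/setP/(_ z): vcE; rewrite !inE => <- <-.
by case: (z \in c); case: (z \in v).
Qed.

Lemma subset_exchange (T : finType) (A c : {set T}) (x y : T) :
  x \in c -> y \notin c ->
  (A \subset exchange c (x, y)) = (x \notin A) && (A :\ y \subset c).
Proof.
move=> xc yc; have nxy : x != y by apply: contraNneq yc => <-.
apply/subsetP/andP => [sub_A|[xA /subsetP sub_A] z zA].
  split; first by apply/negP => /sub_A; rewrite !inE (negbTE nxy) eqxx.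
  by apply/subsetP => z /setD1P[zy /sub_A]; rewrite !inE (negbTE zy) => /andP[].
rewrite !inE; have [//|zy] := eqVneq z y.
by rewrite (sub_A z) ?inE ?zy //= andbT; apply: contraNneq xA => <-.
Qed.

(** The vertices of the sphere other than the centre are the exchanges
    c - x + y, and such an exchange contains A exactly when x avoids A and y
    supplies the only point of A that c may lack.  The two conditions are
    independent, whence a product. *)
Lemma card_sphere_supersets (n w : nat) (c A : {set 'I_n}) : #|c| = w ->
  #|[set v in johnson_sphere1 w c | A \subset v]| =
  (A \subset c) + #|c :\: A| * #|[set y in ~: c | A :\ y \subset c]|.
Proof.
move=> cw; set Y := [set y in ~: c | _]; rewrite -cardsX.
have sub_XY : {subset setX (c :\: A) Y <= setX c (~: c)}.
  by move=> [x y]; rewrite !inE /= => /andP[/andP[_ ->] /andP[-> _]].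
rewrite -(card_in_imset (f := exchange c)); last first.
  by move=> xy xy' /sub_XY xyP /sub_XY xyP'; apply: exchange_inj.
rewrite [LHS](cardsD1 c) in_set in_johnson_sphere1 // cw eqxx setDv cards0 /=.
congr (_ + #|pred_of_set _|); apply/setP => v.
rewrite in_setD1 in_set in_johnson_sphere1 //.
apply/idP/imsetP => [/and3P[vc /andP[/eqP vw le1] Av]|[[x y] xyXY ->]].
  have cv1 : #|c :\: v| = 1.
    apply/eqP; rewrite eqn_leq le1 lt0n cards_eq0 setD_eq0.
    by apply: contra vc => sub_cv; rewrite eq_sym eqEcard sub_cv cw vw /=.
  have [||x [y [xc yc vE]]] := @exchangeP _ c v; rewrite ?cw //.
  exists (x, y) => //; move: Av; rewrite vE subset_exchange //.
  by rewrite !inE xc yc /= => /andP[-> ->].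
have := sub_XY _ xyXY; move: xyXY; rewrite !inE /=.
move=> /andP[/andP[xA _] /andP[_ Ayc]] /andP[xc yc].
rewrite card_exchange // cw eqxx setD_exchange // cards1 subset_exchange //.
rewrite xA Ayc !andbT; apply: contraNneq yc => <-.
by rewrite !inE eqxx.
Qed.

(** The count of the previous lemma depends only on whether A minus c has 0, 1
    or more points.  Counting the points x of A such that c contains A minus x
    distinguishes the same cases, so the count is an affine combination of
    [A \subset c] and of this sum.  Summed over a code, this closes up into a
    recurrence on degrees.  The second term on the left stands there to avoid
    a subtraction. *)
Lemma sphere_count (n w a : nat) (c A : {set 'I_n}) :
  n = 2 * w + a -> #|c| = w -> #|A| <= w ->
  #|[set v in johnson_sphere1 w c | A \subset v]|
    + (A \subset c) * ((w - #|A|).+1 * #|A|) =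
  (A \subset c) * (1 + (w - #|A|) * (w + a))
    + (w - #|A|).+1 * \sum_(x in A) (A :\ x \subset c).
Proof.
move=> nE cw le_Aw; rewrite card_sphere_supersets //.
have subE x : x \in A -> (A :\ x \subset c) = (A :\: c \subset [set x]).
  move=> xA; apply/subsetP/subsetP => sub z.
    rewrite !inE => /andP[zc zA]; apply: contraNT zc => zx.
    by apply: sub; rewrite !inE zx.
  by rewrite !inE => /andP[zx zA]; apply: contraNT zx => zc;
    rewrite -in_set1 sub // inE zc.
have [sub_Ac|nsub_Ac] := boolP (A \subset c).
  have -> : [set y in ~: c | A :\ y \subset c] = ~: c.
    apply/setP => y; rewrite !inE; case: (y \in c) => //=.
    exact: subset_trans (subsetDl _ _) sub_Ac.
  rewrite (eq_bigr (fun _ => 1)) => [|x _]; last first.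
    by rewrite (subset_trans (subsetDl _ _) sub_Ac).
  rewrite sum1_card cardsDS // cw (cardsCs (~: c)) setCK card_ord cw.
  have -> : n - w = w + a by lia.
  by rewrite !mul1n.
rewrite !mul0n add0n addn0.
have : A :\: c != set0 by rewrite setD_eq0.
case/set0Pn => y0 y0Ac; have /setDP[y0A y0c] := y0Ac.
have [Ac1|nAc1] := boolP (A :\: c \subset [set y0]); last first.
  have no x : x \in A -> (A :\ x \subset c) = false.
    move=> xA; rewrite subE //; apply: contraNF nAc1 => sub.
    by have := subsetP sub _ y0Ac; rewrite inE => /eqP ->.
  rewrite big1 => [|x xA]; last by rewrite no.
  rewrite (_ : finset _ = set0) ?cards0 ?muln0 //.
  apply/setP => y; rewrite !inE; case: (boolP (y \in A)) => [yA|yA].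
    by rewrite no // andbF.
  apply: contraNF nsub_Ac => /andP[_]; rewrite (_ : A :\ y = A) //.
  by apply/setDidPl; rewrite disjoint_sym disjoints1.
have AcE : A :\: c = [set y0] by apply/eqP; rewrite eqEsubset Ac1 sub1set.
have -> : [set y in ~: c | A :\ y \subset c] = [set y0].
  apply/setP => y; rewrite !inE; case: (boolP (y \in A)) => [yA|yA].
    rewrite subE // AcE sub1set inE eq_sym; case: eqP => [->|]; by rewrite ?y0c ?andbF.
  have -> : (y == y0) = false by apply: contraNF yA => /eqP ->.
  apply: contraNF nsub_Ac => /andP[_]; rewrite (_ : A :\ y = A) //.
  by apply/setDidPl; rewrite disjoint_sym disjoints1.
rewrite cards1 muln1 (bigD1 y0) //= big1 => [|x /andP[xA xy0]]; last first.
  by rewrite subE // AcE sub1set inE eq_sym (negbTE xy0).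
rewrite subE // AcE subxx addn0 muln1.
have := cardsID c A; have := cardsID A c; rewrite AcE cards1 setIC cw.
set i := #|A :&: c|; set d := #|c :\: A| => cE AE; rewrite -AE; lia.
Qed.

(** * Perfect codes as designs *)

Lemma card_supersets (n w : nat) (A : {set 'I_n}) : #|A| <= w ->
  #|[set v in johnson_vertices n w | A \subset v]| = 'C(n - #|A|, w - #|A|).
Proof.
move=> le_Aw; have -> : n - #|A| = #|~: A|.
  by rewrite [RHS]cardsCs setCK card_ord.
rewrite -cards_draws -(card_in_imset (f := fun B => A :|: B)); last first.
  move=> B B'; rewrite !inE => /andP[BA _] /andP[B'A _] eqU.
  apply/setP => x; move/setP/(_ x): eqU; rewrite !inE.
  case: (boolP (x \in A)) => //= xA _.
  have outA (D : {set 'I_n}) : D \subset ~: A -> (x \in D) = false.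
    by move=> /subsetP DA; apply: contraTF xA => /DA; rewrite inE.
  by rewrite !outA.
congr #|pred_of_set _|; apply/setP => v; rewrite !inE.
apply/andP/imsetP => [[/eqP vw sub_Av]|[B]].
  exists (v :\: A); last first.
    by apply/setP => x; rewrite !inE; case: (boolP (x \in A)) => // /(subsetP sub_Av).
  by rewrite inE cardsDS // vw eqxx setDE subsetIr.
rewrite inE => /andP[BA /eqP cB] ->; rewrite subsetUl cardsU cB.
rewrite (_ : A :&: B = set0) ?cards0 ?subn0 ?subnKC ?eqxx //.
by apply/eqP; rewrite setI_eq0 disjoint_sym disjoints_subset.
Qed.

Lemma sum_sphere_counts (n w : nat) (C : {set {set 'I_n}}) (A : {set 'I_n}) :
  perfect1 w C ->
  \sum_(c in C) #|[set v in johnson_sphere1 w c | A \subset v]| =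
  #|[set v in johnson_vertices n w | A \subset v]|.
Proof.
case=> _ sphere_inj partV; rewrite -sum1dep_card.
rewrite (set_partition_big_cond _ partV) big_imset //=.
by apply: eq_bigr => c _; rewrite sum1dep_card.
Qed.

Definition degree (T : finType) (C : {set {set T}}) (A : {set T}) : nat :=
  #|[set c in C | A \subset c]|.

Lemma degreeE (T : finType) (C : {set {set T}}) (A : {set T}) :
  degree C A = \sum_(c in C) (A \subset c).
Proof. by rewrite /degree -sum1dep_card big_mkcondr. Qed.

(** Double counting of the pairs consisting of a codeword and a vertex of its
    sphere that contains A: each such vertex lies in exactly one sphere. *)
Lemma degree_recurrence (n w a : nat) (C : {set {set 'I_n}}) (A : {set 'I_n}) :
  n = 2 * w + a -> perfect1 w C -> #|A| <= w ->
  'C(n - #|A|, w - #|A|) + degree C A * ((w - #|A|).+1 * #|A|) =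
  degree C A * (1 + (w - #|A|) * (w + a))
    + (w - #|A|).+1 * \sum_(x in A) degree C (A :\ x).
Proof.
move=> nE perfC le_Aw; have [subC _ _] := perfC.
rewrite -card_supersets // -(sum_sphere_counts A perfC) degreeE.
rewrite [X in _ = _ + _ * X](eq_bigr _ (fun x _ => degreeE C (A :\ x))).
rewrite exchange_big /= !big_distrl big_distrr -!big_split /=.
apply: eq_bigr => c /(subsetP subC); rewrite inE => /eqP cw.
exact: sphere_count.
Qed.

(** With e = w - t, the value e^2 + (a+1) e + 1 - w is the eigenvalue of the
    sphere matrix on the t-th eigenspace of J(n, w); it differs from the
    eigenvalue Phi1 for t = 0 by t (n + 1 - t). *)
Lemma Phi1_eigenvalue (w a t : nat) : t <= w ->
  Phi1 w a + w = (w - t) ^ 2 + a.+1 * (w - t) + 1 + t * (2 * w + a - t).+1.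
Proof.
move=> le_tw; rewrite /Phi1 -mulnn; have [e wE] : exists e, w = e + t.
  by exists (w - t); lia.
rewrite wE addnK (_ : 2 * (e + t) + a - t = 2 * e + t + a); last lia.
nia.
Qed.

(** As soon as the eigenvalue for t is nonzero, the recurrence determines the
    degree of a t-set from the degrees of the (t-1)-sets.  The value
    'C(n - t, w - t) / Phi1 is the average degree, so it has to be the
    solution.  The hypothesis says that the eigenvalue is positive for t; as
    it decreases with t, it is then positive for all smaller values. *)
Lemma perfect_degree (n w a : nat) (C : {set {set 'I_n}}) :
  n = 2 * w + a -> perfect1 w C ->
  forall t (A : {set 'I_n}), #|A| = t -> t <= w ->
  w <= (w - t) ^ 2 + a.+1 * (w - t) ->
  Phi1 w a * degree C A = 'C(n - t, w - t).
Proof.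
move=> nE perfC; elim=> [|t IHt] A At le_tw eig_pos.
  have := degree_recurrence nE perfC (A := A).
  rewrite At !subn0 => /(_ le_tw); move/cards0_eq: At => ->.
  by rewrite big_set0 !muln0 !addn0 mulnC => ->.
have := degree_recurrence nE perfC (A := A); rewrite At => /(_ le_tw).
move/(congr1 (muln (Phi1 w a))); rewrite mulnDr [in RHS]mulnDr.
have -> : Phi1 w a * ((w - t.+1).+1 * \sum_(x in A) degree C (A :\ x)) =
    t.+1 * ((w - t.+1).+1 * 'C(n - t, w - t)).
  rewrite mulnCA big_distrr /= (eq_bigr (fun _ => 'C(n - t, w - t))).
    by rewrite sum_nat_const At mulnCA.
  move=> x xA; apply: IHt; last 1 first.
  - have : w - t = (w - t.+1).+1 by lia.
    by rewrite -mulnn in eig_pos *; nia.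
  - by move: At; rewrite (cardsD1 x) xA => -[].
  exact: ltnW.
have -> : w - t = (w - t.+1).+1 by lia.
have -> : n - t = (n - t.+1).+1 by lia.
rewrite -mul_bin_diag /=.
have := Phi1_eigenvalue a le_tw; rewrite -nE.
have : (w - t.+1) + t.+1 = w by lia.
have : n - t.+1 = w - t.+1 + w + a by lia.
move: eig_pos; rewrite -mulnn.
set e := w - t.+1; set N := n - t.+1; set B := 'C(N, e); set X := degree C A.
set F := Phi1 w a => eig_pos NE wE FE.
(* K.+1 is the eigenvalue; both sides of the recurrence reduce to multiples of it. *)
have [K KE] : exists K, e * e + a.+1 * e = w + K by exists (e * e + a.+1 * e - w); lia.
have FK : F = K.+1 + t.+1 * N.+1 by lia.
have sphK : 1 + e * (w + a) = K.+1 + e.+1 * t.+1 by nia.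
rewrite sphK [F * (X * _)]mulnA [F * (X * (_ + _))]mulnA [in F * B]FK => recE.
apply/eqP; rewrite -(eqn_pmul2l (ltn0Sn K)); apply/eqP; move: recE.
by rewrite !mulnDr mulnDl !mulnA; lia.
Qed.
(** * Binomial coefficients and prime powers *)

(** Legendre's formula with a range that can be shared by several factorials. *)
Lemma logn_fact_extended (p n N : nat) : prime p -> n <= N ->
  logn p n`! = \sum_(1 <= k < N.+1) n %/ p ^ k.
Proof.
move=> p_pr le_nN; rewrite logn_fact // [RHS](big_cat_nat (n := n.+1)) //=.
rewrite [X in _ + X]big_nat_cond [X in _ + X]big1 ?addn0 // => k.
rewrite andbT => /andP[lt_nk _].
by rewrite divn_small // (ltn_trans lt_nk) // ltn_expl // prime_gt1.
Qed.

(** Kummer's theorem: the k-th term of the sum is the borrow out of the k lowest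
    digits when m is subtracted from N in base p. *)
Lemma logn_bin_borrows (p N m : nat) : prime p -> m <= N ->
  logn p 'C(N, m) = \sum_(1 <= k < N.+1) (N %% p ^ k < m %% p ^ k).
Proof.
move=> p_pr le_mN; have p_gt0 := prime_gt0 p_pr.
have /(congr1 (logn p)) := bin_fact le_mN.
rewrite !lognM ?muln_gt0 ?fact_gt0 ?bin_gt0 //.
rewrite !(@logn_fact_extended p _ N) ?leq_subr //.
have -> : \sum_(1 <= k < N.+1) N %/ p ^ k =
    \sum_(1 <= k < N.+1) (N %% p ^ k < m %% p ^ k) +
    (\sum_(1 <= k < N.+1) m %/ p ^ k + \sum_(1 <= k < N.+1) (N - m) %/ p ^ k).
  rewrite -!big_split /=; apply: eq_bigr => k _.
  have q_gt0 : 0 < p ^ k by rewrite expn_gt0 p_gt0.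
  rewrite divnB //.
  have := divn_eq N (p ^ k); have := divn_eq m (p ^ k).
  have := ltn_pmod N q_gt0; have := ltn_pmod m q_gt0.
  set q := p ^ k; set x := N %/ q; set y := m %/ q.
  by case: ltnP; nia.
by move/addIn.
Qed.

(** As m ends with u zero digits in base p and N has at most u + 2 digits, only
    the borrow from the top digit of N, at position u + 1, can occur. *)
Lemma logn_bin_le1 (p u N m : nat) : prime p ->
  p ^ u %| m -> m <= N -> N < p ^ u.+2 ->
  logn p 'C(N, m) <= (p ^ u.+1 <= N).
Proof.
move=> p_pr dvd_m le_mN lt_N; rewrite logn_bin_borrows //.
have p_gt1 := prime_gt1 p_pr.
apply: (@leq_trans (\sum_(1 <= k < N.+1 | k == u.+1) (p ^ u.+1 <= N))).
  rewrite [leqRHS]big_mkcond /=; apply: leq_sum => k _.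
  have [lt_ku|lt_uk|->] := ltngtP k u.+1.
  - by rewrite (eqP (dvdn_trans (dvdn_exp2l p (ltnSE lt_ku)) dvd_m)).
  - have lt_Nk : N < p ^ k by rewrite (leq_trans lt_N) // leq_exp2l.
    by rewrite (modn_small lt_Nk) modn_small ?(leq_ltn_trans le_mN) // ltnNge le_mN.
  - have [_|lt_Nu] := leqP (p ^ u.+1) N; first exact: leq_b1.
    by rewrite (modn_small lt_Nu) modn_small ?(leq_ltn_trans le_mN) // ltnNge le_mN.
rewrite big_const_seq; set c := count _ _.
have : c <= 1 by rewrite /c count_uniq_mem ?iota_uniq //; case: (_ \in _).
by case: c => [|[|//]] //= _; rewrite addn0.
Qed.

(** The binomials in the hypothesis form one edge of a triangle in Pascal's
    triangle; each further parallel line consists of differences of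
    neighbours on the line before it. *)
Lemma dvdn_bin_triangle (d n w L : nat) :
  (forall t, t <= L -> d %| 'C(n - t, w - t)) -> L <= w -> L <= n ->
  forall k j, k + j <= L -> d %| 'C(n - (j + k), w - j).
Proof.
move=> edge le_Lw le_Ln; elim=> [|k IHk] j le_kjL.
  by rewrite addn0 edge.
have := IHk j; have := IHk j.+1.
have -> : n - (j + k) = (n - (j + k.+1)).+1 by lia.
have -> : w - j = (w - j.+1).+1 by lia.
have -> : n - (j.+1 + k) = n - (j + k.+1) by lia.
rewrite binS => dvd_left dvd_sum.
by rewrite -(dvdn_addl _ (dvd_left _)) ?dvd_sum; lia.
Qed.

Lemma multiple_in_window (q lo hi : nat) : 0 < q -> q + lo <= hi.+1 ->
  exists2 m, q %| m & lo <= m <= hi.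
Proof.
move=> q_gt0 le_hi; exists ((lo + q.-1) %/ q * q); first exact: dvdn_mull.
have := divn_eq (lo + q.-1) q; have := ltn_pmod (lo + q.-1) q_gt0; lia.
Qed.

(** The two intervals are mirror images of each other in the row w + a + s of
    Pascal's triangle, and they overlap since s + a <= w, so that a q with
    s <= q <= w + a lies itself in one of them; a q below s has a multiple in
    the first interval, which is long enough. *)
Lemma prime_power_multiple (w a s q : nat) :
  0 < q -> q <= w + a -> s + a <= w -> s.*2 <= w + 2 ->
  exists2 m, q %| m & s <= m <= w \/ a + s <= m <= w + a.
Proof.
move=> q_gt0 le_q le_sa le_2s.
have [lt_wq|le_qw] := ltnP w q; first by exists q => //; right; lia.
have [le_sq|lt_qs] := leqP s q; first by exists q => //; left; lia.
have [|m dvd_m m_win] := @multiple_in_window q s w q_gt0; first lia.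
by exists m => //; left.
Qed.

(** The exponent alpha is such that p^(alpha-1) <= w + a < p^alpha.  For a
    multiple m of p^(alpha-1) in the window, p divides the binomial at most
    once, and not at all if w + a + s < p^alpha. *)
Lemma dvdn_window_prime (d w a s p : nat) :
  prime p -> 0 < w -> s + a <= w -> s.*2 <= w + 2 ->
  (forall m, s <= m <= w -> d %| 'C(w + a + s, m)) -> p %| d ->
  p ^ alpha w a p <= w + a + s /\ ~~ (p ^ 2 %| d).
Proof.
move=> p_pr w_gt0 le_sa le_2s window dvd_pd; have p_gt1 := prime_gt1 p_pr.
rewrite /alpha addn1; set u := trunc_log p (w + a).
have wa_gt0 : 0 < w + a by lia.
have /andP[le_q lt_q] : p ^ u <= w + a < p ^ u.+1 by exact: trunc_log_bounds.
have [|m dvd_m m_win] := @prime_power_multiple w a s (p ^ u) _ le_q le_sa le_2s.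
  by rewrite expn_gt0 prime_gt0.
have le_mN : m <= w + a + s by lia.
have dvd_bin : d %| 'C(w + a + s, m).
  case: m_win => m_win; first exact: window.
  by rewrite -bin_sub //; apply: window; lia.
have lt_N : w + a + s < p ^ u.+2.
  apply: (@leq_trans (2 * p ^ u.+1)); first lia.
  by rewrite (expnS p u.+1) leq_mul2r p_gt1 orbT.
have le_log := @logn_bin_le1 p u _ m p_pr dvd_m le_mN lt_N.
have bin_pos : 0 < 'C(w + a + s, m) by rewrite bin_gt0.
split.
  have := dvdn_trans dvd_pd dvd_bin.
  rewrite -{1}(expn1 p) pfactor_dvdn // => /leq_trans/(_ le_log).
  by rewrite lt0b.
apply/negP => dvd_p2d; have := dvdn_trans dvd_p2d dvd_bin.
rewrite pfactor_dvdn // => /leq_trans/(_ le_log).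
by rewrite ltnNge leq_b1.
Qed.

Lemma leq_pow_gap (x y g : nat) : x < y -> 1 < g -> y ^ g.-1 + x ^ g <= y ^ g.
Proof.
case: g => // g lt_xy g_gt1 /=; rewrite !expnS.
apply: leq_trans (leq_mul lt_xy (leqnn _)).
by rewrite mulSn leq_add2l leq_mul2l leq_exp2r ?(ltnW lt_xy) ?orbT.
Qed.

(** Consecutive g-th powers exceeding N differ by more than the square root of
    N when g > 1. *)
Lemma close_powers_eq (N e x y g : nat) : 1 < g -> e ^ 2 <= N ->
  N < x ^ g <= N + e.+1 -> N < y ^ g <= N + e.+1 -> x = y.
Proof.
move=> g_gt1 le_e.
wlog lt_xy : x y / x < y.
  by move=> IH hx hy; have [/IH|/IH|//] := ltngtP x y; [apply|move=> <-].
move=> /andP[lt_x _] /andP[lt_y le_y]; have gap := leq_pow_gap lt_xy g_gt1.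
have y_gt0 : 0 < y by lia.
have le_sq : y ^ g <= (y ^ g.-1) ^ 2 by rewrite -expnM leq_pexp2l //; lia.
have : y ^ g.-1 <= e by lia.
by rewrite -(@leq_exp2r _ _ 2) // => le_ye; lia.
Qed.

(** * Arithmetic consequences for perfect codes *)

Lemma perfect_dvdn_window (n w a s : nat) (C : {set {set 'I_n}}) :
  n = 2 * w + a -> perfect1 w C -> s <= w -> w <= s ^ 2 + a.+1 * s ->
  forall m, s <= m <= w -> Phi1 w a %| 'C(w + a + s, m).
Proof.
move=> nE perfC le_sw eig_pos m m_win.
have edge t : t <= w - s -> Phi1 w a %| 'C(n - t, w - t).
  move=> le_tws; have le_st : s <= w - t by lia.
  have /card_gt0P[A] : 0 < #|[set A : {set 'I_n} | A \subset [set: 'I_n] & #|A| == t]|.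
    by rewrite cards_draws cardsT card_ord bin_gt0; lia.
  rewrite inE subsetT => /eqP At; rewrite -(perfect_degree nE perfC At) ?dvdn_mulr //.
    by lia.
  by rewrite (leq_trans eig_pos) // leq_add ?leq_mul // leq_exp2r.
have := @dvdn_bin_triangle _ n w (w - s) edge _ _ (m - s) (w - m) _.
rewrite (_ : n - _ = w + a + s) 1?(_ : w - (w - m) = m); try lia.
Qed.

(** For w = 1 the graph is complete, so that a perfect code is a single
    vertex. *)
Lemma nontrivial_gt1 (n w a : nat) (C : {set {set 'I_n}}) :
  0 < w -> n = 2 * w + a -> nontrivial_perfect1 w C -> 1 < w.
Proof.
case: w => [|[|w]] // _ nE [perfC []]; left.
have := perfect_degree nE perfC (A := set0) (cards0 _) (leq0n _).
rewrite subn0 -mulnn => /(_ _)/eqP; rewrite bin1 subn0 /Phi1.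
have -> : degree C set0 = #|C|.
  by rewrite /degree; congr #|pred_of_set _|; apply/setP => c;
    rewrite !inE sub0set andbT.
by rewrite [n in _ == n]nE; nia.
Qed.

(** The witness s is the least integer for which the eigenvalue
    s^2 + (a+1) s + 1 - w is positive.  If s were 1, then Phi1 would divide
    w + a + 1, which is too small.  The other bounds follow from
    (s-1)(s+a) < w, which is minimality of s. *)
Lemma nontrivial_window (n w a : nat) (C : {set {set 'I_n}}) :
  0 < w -> n = 2 * w + a -> nontrivial_perfect1 w C ->
  exists2 s, [/\ 1 < s, s + a <= w, s.*2 <= w + 2 & s.-1 ^ 2 <= w + a] &
    forall m, s <= m <= w -> Phi1 w a %| 'C(w + a + s, m).
Proof.
move=> w_gt0 nE nontrivC; have w_gt1 := nontrivial_gt1 w_gt0 nE nontrivC.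
have [perfC _] := nontrivC.
have ex_s : exists s, w <= s ^ 2 + a.+1 * s by exists w; rewrite -mulnn; nia.
have [s eig_pos s_min] := ex_minnP ex_s.
have le_sw : s <= w by apply: s_min; rewrite -mulnn; nia.
have window := perfect_dvdn_window nE perfC le_sw eig_pos.
have s_gt1 : 1 < s.
  case: s eig_pos window {s_min le_sw} => [|[|//]]; first by rewrite muln0; lia.
  move=> _ /(_ 1); rewrite w_gt0 bin1 => /(_ isT)/dvdn_leq.
  by rewrite /Phi1; nia.
exists s => //.
have lt_w : s.-1 ^ 2 + a.+1 * s.-1 < w.
  by rewrite ltnNge; apply/negP => /s_min; lia.
move: lt_w s_gt1; rewrite -mulnn.
by case: s {eig_pos s_min le_sw window} => // s; split=> //; nia.
Qed.

Lemma alpha_gt0 (w a p : nat) : 0 < alpha w a p.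
Proof. by rewrite /alpha addn1. Qed.

Lemma ltn_expn_alpha (w a p : nat) : 1 < p -> w + a < p ^ alpha w a p.
Proof. by move=> p_gt1; rewrite /alpha addn1 trunc_log_ltn. Qed.

(** If g > 1 divides both exponents, the two prime powers are g-th powers that
    are too close to be different, which contradicts p != q by unique
    factorization. *)
Lemma coprime_exponents (N e p q i j : nat) : prime p -> prime q -> p != q ->
  0 < i -> 0 < j -> e ^ 2 <= N ->
  N < p ^ i <= N + e.+1 -> N < q ^ j <= N + e.+1 -> coprime i j.
Proof.
move=> p_pr q_pr neq_pq i_gt0 j_gt0 le_e p_win q_win.
rewrite /coprime eqn_leq gcdn_gt0 i_gt0 andbT leqNgt; apply: contra neq_pq => g_gt1.
set g := gcdn i j in g_gt1.
have iE : i = i %/ g * g by rewrite divnK // dvdn_gcdl.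
have jE : j = j %/ g * g by rewrite divnK // dvdn_gcdr.
rewrite iE expnM in p_win; rewrite jE expnM in q_win.
have i'_gt0 : 0 < i %/ g by rewrite divn_gt0 ?(ltnW g_gt1) // dvdn_leq // dvdn_gcdl.
have j'_gt0 : 0 < j %/ g by rewrite divn_gt0 ?(ltnW g_gt1) // dvdn_leq // dvdn_gcdr.
have eq_pow := close_powers_eq g_gt1 le_e p_win q_win.
have := Euclid_dvdX p (i %/ g) q_pr; rewrite eq_pow Euclid_dvdX // dvdnn j'_gt0 i'_gt0.
by rewrite !andbT => /esym; rewrite dvdn_prime2 // => /eqP ->.
Qed.

Theorem lemma5 (w a n : nat) (hw : 1 <= w) (hn : n = 2 * w + a)
  (hC : exists C : {set {set 'I_n}}, nontrivial_perfect1 w C)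
  (r : nat) (p : 'I_r -> nat) (hp : forall i : 'I_r, prime (p i))
  (hprod : Phi1 w a = \prod_(i < r) p i) :
  forall i j : 'I_r, i <> j ->
    alpha w a (p i) <> alpha w a (p j) /\
    coprime (alpha w a (p i)) (alpha w a (p j)).
Proof.
move=> i j /eqP neq_ij; case: hC => C nontrivC.
have [s [s_gt1 le_saw le_2s le_s2] window] := nontrivial_window hw hn nontrivC.
have dvd_pij : p i * p j %| Phi1 w a.
  rewrite hprod (bigD1 i) //= (bigD1 j) 1?eq_sym //= mulnA.
  exact: dvdn_mulr.
have p_window k : p k %| Phi1 w a ->
    p k ^ alpha w a (p k) <= w + a + s /\ ~~ (p k ^ 2 %| Phi1 w a).
  exact: dvdn_window_prime.
have [le_i sqfree] := p_window i (dvdn_trans (dvdn_mulr _ (dvdnn _)) dvd_pij).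
have [le_j _] := p_window j (dvdn_trans (dvdn_mull _ (dvdnn _)) dvd_pij).
have neq_p : p i != p j.
  by apply: contra sqfree => /eqP eq_p; rewrite -mulnn {2}eq_p.
have lt_alpha k : w + a < p k ^ alpha w a (p k) by rewrite ltn_expn_alpha ?prime_gt1.
have co_ij : coprime (alpha w a (p i)) (alpha w a (p j)).
  apply: (@coprime_exponents (w + a) s.-1 (p i) (p j)); rewrite ?alpha_gt0 //.
    by rewrite lt_alpha prednK // ltnW.
  by rewrite lt_alpha prednK // ltnW.
split=> // eq_alpha; move: co_ij; rewrite eq_alpha /coprime gcdnn => /eqP alpha_j1.
have := lt_alpha i; have := lt_alpha j; rewrite eq_alpha alpha_j1 !expn1.
move=> lt_j lt_i.
have := leq_trans (leq_mul lt_i lt_j) (dvdn_leq (isT : 0 < Phi1 w a) dvd_pij).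
have : w * (w + a) <= (w + a) * (w + a) by rewrite leq_mul2r leq_addr orbT.
by rewrite /Phi1 mulSn mulnS; lia.
Qed.
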